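(* Let $E$ be an $n$-dimensional vector space over a field $\mathbb{F}$, and let $(E,\mathcal{I})$ be a $q$-matroid given by its collection of independent spaces, i.e. $\mathcal{I}\subseteq\mathcal{L}(E)$ satisfies (I1), (I2), (I3) and (I4). Define \[ \mathcal{C}_{\mathcal{I}}=\{C\subseteq E \text{ a subspace}: C\notin\mathcal{I},\ I\in\mathcal{I}\text{ for all subspaces } I\subsetneq C\}. \] Then $\mathcal{C}_{\mathcal{I}}$ is a family of circuits, that is, it satisfies the axioms (C1), (C2) and (C3).
   Context: $n$ is a positive integer, $\mathbb{F}$ is an arbitrary field, and $\mathcal{L}(E)$ denotes the lattice of all subspaces of $E$; for a subspace $A$, $\mathcal{L}(A)$ is the set of all subspaces of $A$. For a family $\mathcal{A}\subseteq\mathcal{L}(E)$, $\max(\mathcal{A})$ is the set of members of $\mathcal{A}$ that are maximal with respect to inclusion. Independence axioms for $\mathcal{I}\subseteq\mathcal{L}(E)$: (I1) $\mathcal{I}\neq\emptyset$. (I2) For all $I,J\in\mathcal{L}(E)$, if $J\in\mathcal{I}$ and $I\subseteq J$, then $I\in\mathcal{I}$. (I3) For all $I,J\in\mathcal{I}$ with $\dim I<\dim J$, there exists a $1$-dimensional subspace $x\subseteq J$, $x\not\subseteq I$, such that $I+x\in\mathcal{I}$. (I4) For all $A,B\in\mathcal{L}(E)$ and $I,J\in\mathcal{L}(E)$ such that $I\in\max(\mathcal{I}\cap\mathcal{L}(A))$ and $J\in\max(\mathcal{I}\cap\mathcal{L}(B))$, there exists $K\in\max(\mathcal{I}\cap\mathcal{L}(A+B))$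 such that $K\subseteq I+J$. Circuit axioms for $\mathcal{C}\subseteq\mathcal{L}(E)$: (C1) $\{0\}\notin\mathcal{C}$. (C2) For all $C_1,C_2\in\mathcal{C}$, if $C_1\subseteq C_2$, then $C_1=C_2$. (C3) For distinct $C_1,C_2\in\mathcal{C}$ and any $X\in\mathcal{L}(E)$ of codimension $1$ in $E$, there is $C_3\in\mathcal{C}$ such that $C_3\subseteq(C_1+C_2)\cap X$. *)

(* Defs.v *)
From HB Require Import structures.
From mathcomp Require Import all_boot all_algebra.
From mathcomp Require Import classical_sets.

Set Implicit Arguments.
Unset Strict Implicit.
Unset Printing Implicit Defensive.

Local Open Scope classical_set_scope.

Section QMatroid.
Variables (F : fieldType) (E : vectType F).

(* Families of subspaces are arbitrary (Prop-valued) sets, since there are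
   infinitely many subspaces when F is infinite and dim E > 1. *)
Implicit Types (Ind Circ Fam : set {vspace E}).

Definition subspaces (A : {vspace E}) : set {vspace E} :=
  [set U | (U <= A)%VS].

Definition maxsp Fam : set {vspace E} :=
  [set U | Fam U /\ forall V, Fam V -> (U <= V)%VS -> V = U].

Definition axI1 Ind : Prop := Ind !=set0.

Definition axI2 Ind : Prop :=
  forall I J : {vspace E}, Ind J -> (I <= J)%VS -> Ind I.

Definition axI3 Ind : Prop :=
  forall I J : {vspace E}, Ind I -> Ind J -> (\dim I < \dim J)%N ->
  exists x : {vspace E},
    [/\ \dim x = 1%N, (x <= J)%VS, ~~ (x <= I)%VS & Ind (I + x)%VS].

Definition axI4 Ind : Prop :=
  forall A B I J : {vspace E},
    maxsp (Ind `&` subspaces A) I -> maxsp (Ind `&` subspaces B) J ->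
  exists K : {vspace E},
    maxsp (Ind `&` subspaces (A + B)%VS) K /\ (K <= I + J)%VS.

Definition qmatroid Ind : Prop :=
  [/\ axI1 Ind, axI2 Ind, axI3 Ind & axI4 Ind].

Definition axC1 Circ : Prop := ~ Circ 0%VS.

Definition axC2 Circ : Prop :=
  forall C1 C2 : {vspace E}, Circ C1 -> Circ C2 -> (C1 <= C2)%VS -> C1 = C2.

(* The codimension condition is written additively to avoid truncated
   subtraction on nat. *)
Definition axC3 Circ : Prop :=
  forall C1 C2 X : {vspace E}, Circ C1 -> Circ C2 -> C1 <> C2 ->
    (\dim X + 1)%N = \dim {:E} ->
  exists C3 : {vspace E}, Circ C3 /\ (C3 <= (C1 + C2) :&: X)%VS.

Definition circuit_family Circ : Prop :=
  [/\ axC1 Circ, axC2 Circ & axC3 Circ].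

Definition circuits_of Ind : set {vspace E} :=
  [set C | ~ Ind C /\
           forall I : {vspace E}, (I <= C)%VS -> I <> C -> Ind I].

End QMatroid.

(* Main.v *)
Require Import Defs.
From mathcomp Require Import all_boot all_algebra.
From mathcomp Require Import boolp classical_sets.

(** Let [C1 <> C2] be circuits and [X] a hyperplane.  A dependent space contains
    a circuit, so for (C3) it is enough that [(C1 + C2) :&: X], whose dimension is
    at least [\dim (C1 + C2) - 1], is dependent.  This is a rank count: the
    rank of [C1 + C2] is at most [\dim (C1 + C2) - 2].  In a matroid such a
    bound comes from submodularity of the rank function; here (I4) gives
    directly the one instance that matters.  Let [I] and [J] be hyperplanes of
    [C1] and [C2] through [C1 :&: C2] (a proper subspace of both, by (C2)).
    They are independent, hence maximal independent in [C1] and [C2], so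
    (I4) puts some maximal independent subspace [K] of [C1 + C2] inside
    [I + J].  As [I] and [J] still meet in at least [C1 :&: C2],
    [\dim (I + J) <= (\dim C1 - 1) + (\dim C2 - 1) - \dim (C1 :&: C2)
                   = \dim (C1 + C2) - 2].
    Were [(C1 + C2) :&: X] independent, (I3) would enlarge [K] inside
    [C1 + C2], against its maximality. *)

Section Subspaces.
Set Implicit Arguments.
Unset Strict Implicit.
Context {F : fieldType} {E : vectType F}.
Implicit Types (A C M U X : {vspace E}).

Lemma exists_hyperplane_through M C : (M <= C)%VS -> M <> C ->
  exists H : {vspace E}, [/\ (M <= H)%VS, (H <= C)%VS & (\dim H).+1 = \dim C].
Proof.
move=> sMC neMC.
set D := (C :\: M)%VS.
have dimD : (\dim M + \dim D)%N = \dim C.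
  by rewrite -(dimv_cap_compl C M) (capv_idPr sMC).
have nzD : D != 0%VS.
  rewrite -dimv_eq0; apply/eqP => D0; apply: neMC; apply/eqP.
  by rewrite eqEdim sMC -dimD D0 addn0 /=.
pose v := vpick D.
have lineD : (<[v]> <= D)%VS by rewrite -memvE memv_pick.
(* Removing one line from the complement of [M] in [C] costs one dimension. *)
pose D' := (D :\: <[v]>)%VS.
have dimD' : (\dim D').+1 = \dim D.
  by rewrite -(dimv_cap_compl D <[v]>) (capv_idPr lineD) dim_vline vpick0 nzD.
have sD'D : (D' <= D)%VS by apply: diffvSl.
exists (M + D')%VS; split; first exact: addvSl.
  by rewrite subv_add sMC (subv_trans sD'D (diffvSl _ _)).
rewrite dimv_disjoint_sum -?addnS ?dimD' //.
by apply/eqP; rewrite -subv0 -(capv_diff C M) capvC capvS.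
Qed.

Lemma dim_cap_hyperplane U X : (\dim X + 1)%N = \dim {:E} ->
  (\dim U <= (\dim (U :&: X)).+1)%N.
Proof.
move=> dimX; rewrite -(leq_add2r (\dim X)) addSnnS -addn1 dimX.
by rewrite -dimv_sum_cap addnC leq_add2l dimvS ?subvf.
Qed.

End Subspaces.

Section Circuits.
Set Implicit Arguments.
Unset Strict Implicit.
Context {F : fieldType} {E : vectType F} {Ind : set {vspace E}}.
Implicit Types (C D H : {vspace E}).

(** Take a dependent subspace of [D] of least dimension: such a descent ends
    even over an infinite field, where [D] has infinitely many subspaces. *)
Lemma dependent_contains_circuit D : ~ Ind D ->
  exists C, circuits_of Ind C /\ (C <= D)%VS.
Proof.
have [m] := ubnP (\dim D); elim: m D => // m IHm D ltDm depD.
have [circD|noncircD] := pselect (circuits_of Ind D); first by exists D.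
have [U [sUD neUD depU]] : exists U, [/\ (U <= D)%VS, U <> D & ~ Ind U].
  apply: contrapT => noU; apply: noncircD; split=> // U sUD neUD.
  by apply: contrapT => depU; apply: noU; exists U.
have ltUD : (\dim U < \dim D)%N.
  rewrite ltnNge; apply/negP => leDU; apply: neUD; apply/eqP.
  by rewrite eqEdim sUD.
have [C [circC sCU]] := IHm U (leq_trans ltUD ltDm) depU.
by exists C; split=> //; apply: subv_trans sUD.
Qed.

Lemma circuit_inclusion_minimal : axC2 (circuits_of Ind).
Proof.
move=> C1 C2 [depC1 _] [_ indC2] sC12.
by apply: contrapT => neC12; apply: depC1; apply: indC2.
Qed.

(** This is what makes (I4) applicable to circuits: every hyperplane of a
    circuit may be chosen as its maximal independent subspace. *)
Lemma circuit_hyperplane_maximal C H : circuits_of Ind C ->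
  (H <= C)%VS -> (\dim H).+1 = \dim C -> maxsp (Ind `&` subspaces C)%classic H.
Proof.
move=> [depC indC] sHC dimH; split; first split=> //.
  by apply: indC => // eHC; move/eqP: dimH; rewrite eHC eqn_leq ltnn.
move=> V [indV sVC] sHV; apply/esym/eqP; rewrite eqEdim sHV -ltnS dimH /=.
rewrite ltnNge; apply/negP => leCV; apply: depC.
suff -> : C = V by [].
by apply/esym/eqP; rewrite eqEdim sVC.
Qed.

Lemma maximal_independent_dim A K D : axI3 Ind ->
  maxsp (Ind `&` subspaces A)%classic K -> Ind D -> (D <= A)%VS ->
  (\dim D <= \dim K)%N.
Proof.
move=> I3 [[indK sKA] maxK] indD sDA.
rewrite leqNgt; apply/negP => ltKD.
have [x [_ sxD nsxK indKx]] := I3 K D indK indD ltKD.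
have sKxA : (K + x <= A)%VS by rewrite subv_add sKA (subv_trans sxD).
have eKx : (K + x)%VS = K by apply: maxK => //; apply: addvSl.
by case/negP: nsxK; rewrite -eKx addvSr.
Qed.

(** Each circuit falls one dimension short of being independent.  Choosing both
    hyperplanes through [C1 :&: C2] keeps their intersection from shrinking,
    so that the two losses add up in [I + J]. *)
Lemma maximal_independent_sum_circuits C1 C2 : axI4 Ind ->
  circuits_of Ind C1 -> circuits_of Ind C2 -> C1 <> C2 ->
  exists K, maxsp (Ind `&` subspaces (C1 + C2)%VS)%classic K /\
    ((\dim K).+2 <= \dim (C1 + C2))%N.
Proof.
move=> I4 circC1 circC2 neC12.
have neM1 : (C1 :&: C2)%VS <> C1.
  by move/capv_idPl=> sC12; apply/neC12/circuit_inclusion_minimal.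
have neM2 : (C1 :&: C2)%VS <> C2.
  by move/capv_idPr=> sC21; apply/neC12/esym/circuit_inclusion_minimal.
have [I [sMI sIC dimI]] := exists_hyperplane_through (capvSl C1 C2) neM1.
have [J [sMJ sJC dimJ]] := exists_hyperplane_through (capvSr C1 C2) neM2.
have [K [maxK sKIJ]] := I4 C1 C2 I J
  (circuit_hyperplane_maximal circC1 sIC dimI)
  (circuit_hyperplane_maximal circC2 sJC dimJ).
exists K; split=> //.
have sMIJ : (C1 :&: C2 <= I :&: J)%VS by rewrite subv_cap sMI.
rewrite -(leq_add2r (\dim (C1 :&: C2))) dimv_sum_cap -dimI -dimJ !addSn addnS.
by rewrite !ltnS -(dimv_sum_cap I J) leq_add ?dimvS.
Qed.

Lemma circuit_elimination : axI3 Ind -> axI4 Ind -> axC3 (circuits_of Ind).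
Proof.
move=> I3 I4 C1 C2 X circC1 circC2 neC12 dimX.
apply: dependent_contains_circuit => indD.
have [K [maxK dimK]] := maximal_independent_sum_circuits I4 circC1 circC2 neC12.
have leDK := maximal_independent_dim I3 maxK indD (capvSl _ _).
have := leq_trans dimK (dim_cap_hyperplane (C1 + C2)%VS dimX).
by rewrite ltnS ltnNge leDK.
Qed.

End Circuits.

Theorem theorem33 (n : nat) (n_gt0 : (0 < n)%N) (F : fieldType)
    (E : vectType F) (dimE : \dim {:E} = n) (Ind : set {vspace E}) :
  qmatroid Ind -> circuit_family (circuits_of Ind).
Proof.
move=> [[I0 indI0] I2 I3 I4]; split.
- by move=> [dep0 _]; apply: dep0; apply: I2 indI0 (sub0v _).
- exact: circuit_inclusion_minimal.
- exact: circuit_elimination.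
Qed.
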